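(* Let $I\subset\mathbb R$ be an interval with $\sup I=0$, let $(M,g(t))_{t\in I}$ be a Ricci flow satisfying (RF4) with constant $K\ge 1$, and let $\rho\ge2K$. Then the following hold. 1. For any $x,y\in M$, $D_\rho(x,y)=D_\rho(y,x)\ge0$. 2. For any $x,y\in M$ and $0<\bar r<\sqrt{-\inf I}$, $D_\rho(x,y)<\bar r$ if and only if $d_{g(-\bar r^2)}(x,y)<\bar r\rho$. In particular, $D_\rho(x,y)=0$ if and only if $d_{g(-r^2)}(x,y)<r\rho$ for every $r\in(0,\sqrt{-\inf I})$. 3. If $\rho_i\ge\rho-K>K$, $i=1,2$, then for any $x,y,z\in M$ $$(\rho-K)D_\rho(x,y)\le\rho_1D_{\rho_1}(x,z)+\rho_2D_{\rho_2}(z,y).$$ In particular, $$D_\rho(x,y)\le\frac{\max(\rho_1,\rho_2)}{\rho-K}\big(D_{\rho_1}(x,z)+D_{\rho_2}(z,y)\big),$$ and if $\rho_1=\rho_2=\rho-K$, then $D_\rho(x,y)\le D_{\rho-K}(x,z)+D_{\rho-K}(z,y)$. 4. If $K\le\rho_1\le\rho_2$ then $D_{\rho_2}(x,y)\le D_{\rho_1}(x,y)$, and (when $\rho_1>K$) $D_{\rho_1}(x,y)\le\frac{\rho_2-K}{\rho_1-K}D_{\rho_2}(x,y)$, for any $x,y\in M$. 5. If $\rho_i\ge2K$, $i=1,2$, then for any $x,y,z\in M$ $$D_{\rho_1+\rho_2}(x,z)\le\max\big(D_{\rho_1}(x,y),D_{\rho_2}(y,z)\big).$$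
   Context: A Ricci flow is a smooth family of Riemannian metrics with $\partial_tg=-2\mathrm{Ric}_{g(t)}$, and $d_{g(t)}$ is the Riemannian distance of $g(t)$. (RF4) with constant $K$ means: for every $x,y\in M$ and $s,t\in I$ with $s<t$, $d_{g(s)}(x,y)\le d_{g(t)}(x,y)+K(\sqrt{|s|}-\sqrt{|t|})$. For $\rho\ge K$ the $\rho$-scale between $x,y\in M$ is $$D_\rho(x,y)=\inf\{r\in(0,\sqrt{-\inf I}):\ d_{g(-r^2)}(x,y)<r\rho\},$$ with $D_\rho(x,y)=+\infty$ if the set is empty ($\sqrt{-\inf I}=+\infty$ if $I$ is unbounded).
   Formalization: I is assumed to contain some t<0; the three inequalities in item 3 and the second one in item 4 are asserted only if I is unbounded, or the left-hand scale D is finite, or the resulting upper bound for D is below sqrt(-inf I), as they can fail otherwise. *)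

(* Defs.v *)
From HB Require Import structures.
From mathcomp Require Import all_boot all_order all_algebra.
From mathcomp Require Import all_classical all_reals all_analysis.

Set Implicit Arguments.
Unset Strict Implicit.
Unset Printing Implicit Defensive.

Import Order.TTheory GRing.Theory Num.Theory.
Import numFieldNormedType.Exports.

Local Open Scope classical_set_scope.
Local Open Scope ring_scope.

(** * Smooth maps

    [Ck k U f]: all iterated directional derivatives of [f] of order at most
    [k] exist and are continuous on the open set [U]; in finite dimension
    (the only case used) this is the usual class C^k.  [smooth_on A f] is
    meant for an arbitrary set [A], e.g. the product of an interval containing
    its endpoint and an open set: [f] locally extends to a C^oo map. *)

Fixpoint Ck (R : realType) (V W : normedModType R) (k : nat) (U : set V)
    (f : V -> W) : Prop :=
  (forall p, U p -> {for p, continuous f}) /\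
  match k with
  | 0 => True
  | k'.+1 => (forall p v, U p -> derivable f p v) /\
             (forall v, Ck k' U ('D_v f))
  end.

Definition smooth_on (R : realType) (V W : normedModType R) (A : set V)
    (f : V -> W) : Prop :=
  forall p, A p -> exists (U : set V) (F : V -> W),
    [/\ open U, U p, (forall k, Ck k U F) &
        forall q, U q -> A q -> F q = f q].

(** Derivative relative to a set of parameters: two-sided at interior points
    of [A], one-sided at the endpoints of an interval [A]. *)
Definition is_derive_within (R : realType) (W : normedModType R) (A : set R)
    (f : R -> W) (t : R) (v : W) : Prop :=
  (fun s => (s - t)^-1 *: (f s - f t)) @ within A (dnbhs t) --> v.

Definition C1_on (R : realType) (W : normedModType R) (a b : R)
    (f v : R -> W) : Prop :=
  {within `[a, b], continuous v} /\
  forall s, a <= s <= b -> is_derive_within `[a, b] f s (v s).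

(** * Smooth manifolds *)

(** [cmap] and [cinv] are total functions; their values outside [cdom] and
    [ccod] are irrelevant. *)
Record chart (R : realType) (M : topologicalType) (n : nat) := Chart {
  cdom : set M ;
  cmap : M -> 'rV[R]_n ;
  cinv : 'rV[R]_n -> M ;
  cdom_open : open cdom ;
  ccod_open : open (cmap @` cdom) ;
  cmapK : forall x, cdom x -> cinv (cmap x) = x ;
  cmap_continuous : forall x, cdom x -> {for x, continuous cmap} ;
  cinv_continuous : forall p, (cmap @` cdom) p -> {for p, continuous cinv} }.

Definition ccod (R : realType) (M : topologicalType) (n : nat)
  (c : chart R M n) : set 'rV[R]_n := cmap c @` cdom c.

Definition overlap (R : realType) (M : topologicalType) (n : nat)
  (c c' : chart R M n) : set 'rV[R]_n := cmap c @` (cdom c `&` cdom c').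

Definition transition (R : realType) (M : topologicalType) (n : nat)
  (c c' : chart R M n) : 'rV[R]_n -> 'rV[R]_n := cmap c' \o cinv c.

Record is_smooth_manifold (R : realType) (M : topologicalType) (n : nat)
    (atlas : set (chart R M n)) : Prop := {
  manifold_hausdorff : hausdorff_space M ;
  manifold_second_countable : @second_countable M ;
  atlas_cover : forall x : M, exists2 c, atlas c & cdom c x ;
  atlas_smooth : forall c c', atlas c -> atlas c' ->
    smooth_on (overlap c c') (transition c c') }.

(** * Riemannian metrics, given by their components in the charts *)

Definition components (R : realType) (M : topologicalType) (n : nat) :=
  chart R M n -> 'rV[R]_n -> 'M[R]_n.

(** The library's [jacobian] acts on row vectors, [v |-> v *m J], so that the
    last condition is the transformation law of a covariant 2-tensor. *)
Record is_metric (R : realType) (M : topologicalType) (n : nat)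
    (atlas : set (chart R M n)) (g : components R M n) : Prop := {
  metric_smooth : forall c (i j : 'I_n), atlas c ->
    smooth_on (ccod c) (fun p => g c p i j : R^o) ;
  metric_sym : forall c p, atlas c -> ccod c p -> (g c p)^T = g c p ;
  metric_pos : forall c p (v : 'rV[R]_n), atlas c -> ccod c p -> v != 0 ->
    0 < (v *m g c p *m v^T) 0 0 ;
  metric_tensor : forall c c' p, atlas c -> atlas c' -> overlap c c' p ->
    let J := jacobian (transition c c') p in
    g c p = J *m g c' (transition c c' p) *m J^T }.

(** * Riemannian distance

    [curve_length atlas g gamma a b L]: on [a, b] the curve [gamma] is
    piecewise C^1 and has length [L] for [g].  The curve is subdivided so that
    each piece is C^1 and stays in one chart, in which the integral of the
    norm of its velocity [v] is computed; by the transformation law, [L] does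
    not depend on the subdivision nor on the charts. *)
Inductive curve_length (R : realType) (M : topologicalType) (n : nat)
    (atlas : set (chart R M n)) (g : components R M n) (gamma : R -> M)
    (a : R) : R -> \bar R -> Prop :=
| curve_length_nil : curve_length atlas g gamma a a 0%E
| curve_length_rcons (b b' : R) (L : \bar R) (c : chart R M n)
    (v : R -> 'rV[R]_n) :
    curve_length atlas g gamma a b L ->
    b < b' -> atlas c ->
    (forall s, b <= s <= b' -> cdom c (gamma s)) ->
    C1_on b b' (cmap c \o gamma) v ->
    curve_length atlas g gamma a b'
      (L + \int[lebesgue_measure]_(s in `[b, b'])
         (Num.sqrt ((v s *m g c (cmap c (gamma s)) *m (v s)^T) 0 0))%:E)%E.

(** The distance between two points of different connected components is
    [+oo]. *)
Definition riem_dist (R : realType) (M : topologicalType) (n : nat)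
    (atlas : set (chart R M n)) (g : components R M n) (x y : M) : \bar R :=
  ereal_inf [set L | exists (gamma : R -> M) (a b : R),
    [/\ gamma a = x, gamma b = y & curve_length atlas g gamma a b L]].

(** * Ricci curvature in local coordinates *)

Definition partial (R : realType) (n : nat) (i : 'I_n) (f : 'rV[R]_n -> R^o)
  (p : 'rV[R]_n) : R := 'D_(delta_mx 0 i) f p.

(** Christoffel symbol $\Gamma^k_{ij}$. *)
Definition christoffel (R : realType) (n : nat) (g : 'rV[R]_n -> 'M[R]_n)
    (k i j : 'I_n) (p : 'rV[R]_n) : R :=
  2^-1 * \sum_l invmx (g p) k l *
    (partial i (fun q => g q j l) p + partial j (fun q => g q i l) p
     - partial l (fun q => g q i j) p).

(** $R_{ij} = \partial_k\Gamma^k_{ij} - \partial_j\Gamma^k_{ik}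
      + \Gamma^k_{kl}\Gamma^l_{ij} - \Gamma^k_{jl}\Gamma^l_{ik}$
    (positive on round spheres). *)
Definition ricci (R : realType) (n : nat) (g : 'rV[R]_n -> 'M[R]_n)
    (i j : 'I_n) (p : 'rV[R]_n) : R :=
  \sum_k (partial k (christoffel g k i j) p - partial j (christoffel g k i k) p)
  + \sum_k \sum_l (christoffel g k k l p * christoffel g l i j p
                   - christoffel g k j l p * christoffel g l i k p).

(** * Ricci flow *)

Record is_ricci_flow (R : realType) (M : topologicalType) (n : nat)
    (atlas : set (chart R M n)) (I : set R) (g : R -> components R M n)
    : Prop := {
  flow_metric : forall t, I t -> is_metric atlas (g t) ;
  flow_smooth : forall c (i j : 'I_n), atlas c ->
    smooth_on (I `*` ccod c)
      (fun tp : (R^o * 'rV[R]_n)%type => g tp.1 c tp.2 i j : R^o) ;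
  flow_eq : forall c (i j : 'I_n) t p, atlas c -> I t -> ccod c p ->
    is_derive_within I (fun s => g s c p i j : R^o) t
      (- 2 * ricci (g t c) i j p) }.

Definition RF4 (R : realType) (M : Type) (I : set R)
    (d : R -> M -> M -> \bar R) (K : R) : Prop :=
  forall (x y : M) (s t : R), I s -> I t -> s < t ->
    (d s x y <= d t x y + (K * (Num.sqrt `|s| - Num.sqrt `|t|))%:E)%E.

(** * The scale $D_\rho$ *)

(** $\sqrt{-\inf I}$, which is [+oo] when [I] is unbounded below. *)
Definition horizon (R : realType) (I : set R) : \bar R :=
  sqrte (- ereal_inf [set t%:E | t in I])%E.

(** [ereal_inf set0 = +oo]. *)
Definition rho_scale (R : realType) (M : Type) (I : set R)
    (d : R -> M -> M -> \bar R) (rho : R) (x y : M) : \bar R :=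
  ereal_inf [set r%:E | r in
    [set r : R | [/\ 0 < r, (r%:E < horizon I)%E &
                     (d (- r ^+ 2)%R x y < (r * rho)%:E)%E]]].

(** When [I] is bounded below, an upper bound [B] for a scale [D] that is
    itself at least the horizon says nothing about the times in [I], and [D]
    may then be [+oo] although [B] is finite.  On the static flow of the
    Euclidean space over ]-1, 0[, which satisfies [RF4] with [K = 1], one has
    [D_rho(x, y) = |x - y| / rho] if this is less than 1 and [+oo] otherwise;
    if [z] is the midpoint of [x, y] and [|x - y| = 3.5], then
    [D_3(x, y) = +oo] while [D_2(x, z) + D_2(z, y) = 1.75], and if
    [|x - y| = 2.5] then [D_2(x, y) = +oo] while [2 * D_3(x, y) < 2].
    [bound_applies I D B] rules out exactly this situation; it holds as soon
    as [I] is unbounded, or [D] is finite, or [B] is below the horizon. *)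
Definition bound_applies (R : realType) (I : set R) (D B : \bar R) : Prop :=
  [\/ horizon I = +oo, D < +oo | B < horizon I]%E.

(* Main.v *)
Require Import Defs.
From HB Require Import structures.
From mathcomp Require Import all_boot all_order all_algebra.
From mathcomp Require Import all_classical all_reals all_analysis.
From mathcomp Require Import measurable_realfun ring lra.

Set Implicit Arguments.
Unset Strict Implicit.
Unset Printing Implicit Defensive.

Import Order.TTheory GRing.Theory Num.Theory.
Import numFieldNormedType.Exports.
Local Open Scope classical_set_scope.
Local Open Scope ring_scope.

(** Write d_r for the distance at time - r ^+ 2.  In this parameter [RF4] says
    that d_s(x, y) <= d_r(x, y) + K * (s - r) for r <= s: going back in time,
    distances grow at rate at most K.  As r * rho grows at rate rho >= K, the
    condition d_r(x, y) < r * rho, once true, stays true for all larger r.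
    The radii admitted in the definition of D_rho(x, y) thus form an interval
    reaching up to the horizon, whose lower end is D_rho(x, y)
    ([rho_scale_lt]).  It does not contain its lower end, because the
    distance between two given points is upper semicontinuous in time
    ([lt_rho_scale], [riem_dist_flow_usc]); hence D_rho(x, y) < r if and only if
    r is admissible.  Upper semicontinuity holds since a nearly minimizing curve
    is compact and the metric is continuous in time and space, so that its
    length changes little for nearby times.

    The inequalities between scales are then arithmetic.  For the triangle
    inequality with weights, let r1 > D_rho1(x, z) and r2 > D_rho2(z, y).  The
    triangle inequality is used at the time of radius s = max(r1, r2), where
    only the term with the smaller radius has been moved, and [RF4] is then
    applied once more, to the pair (x, y), up to the radius
    r = (rho1 * r1 + rho2 * r2) / (rho - K).  The total error is
    K * (r - min(r1, r2)) <= K * r, whence d_r(x, y) < r * rho.  Moving both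
    terms separately to the radius r would cost 2 * K * r - K * (r1 + r2),
    which is too much ([dist_lt_add]).

    The distance enters only through four properties: symmetry, the triangle
    inequality, [RF4] and upper semicontinuity in time.  The first two
    require that curves can be reversed and concatenated, hence that length
    is invariant under the affine maps s |-> e * s + k with e = 1 or -1. *)

(** * Limits of norms, and derivatives relative to a set *)

Definition speed (R : realType) (M : topologicalType) (n : nat)
    (g : components R M n) (c : chart R M n) (gamma : R -> M)
    (v : R -> 'rV[R]_n) (s : R) : R :=
  Num.sqrt ((v s *m g c (cmap c (gamma s)) *m (v s)^T) 0 0).

Lemma cvg_norm_mx (R : realType) (n : nat) (T : Type) (F : set_system T)
    (FF : Filter F) (v : T -> 'rV[R]_n) (G : T -> 'M[R]_n) (v0 : 'rV[R]_n)
    (G0 : 'M[R]_n) :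
  v @ F --> v0 ->
  (forall i j, (fun x => G x i j) @ F --> G0 i j) ->
  (fun x => Num.sqrt ((v x *m G x *m (v x)^T) 0 0)) @ F -->
    Num.sqrt ((v0 *m G0 *m v0^T) 0 0).
Proof.
move=> cv cG; apply: continuous_cvg; first exact: sqrt_continuous.
have cvi i : (fun x => v x 0 i) @ F --> v0 0 i.
  by apply: (cvg_comp v (fun w : 'rV[R]_n => w 0 i) cv); exact: coord_continuous.
rewrite (_ : (fun x => _) = fun x => \sum_j (\sum_k v x 0 k * G x k j) * v x 0 j).
  rewrite mxE; under eq_bigr do rewrite !mxE.
  apply: cvg_big => [|j _]; first exact: add_continuous.
  apply: cvgM => //; apply: cvg_big => [|i _]; first exact: add_continuous.
  exact: cvgM.
by apply/funext => x; rewrite mxE; apply: eq_bigr => j _; rewrite !mxE.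
Qed.

Lemma is_derive_within_cvg (R : realType) (W : normedModType R) (A : set R)
    (f : R -> W) (t : R) (v : W) :
  is_derive_within A f t v -> f @ within A (nbhs t) --> f t.
Proof.
move=> ft; have c : (fun s => (s - t) *: ((s - t)^-1 *: (f s - f t)) + f t)
    @ within A (dnbhs t) --> 0 *: v + f t.
  apply: cvgD; last exact: cvg_cst.
  apply: cvgZ => //; rewrite -[X in _ --> X](subrr t).
  apply: cvg_within_filter; apply: cvg_within_filter.
  by apply: cvgB; [exact: cvg_id|exact: cvg_cst].
rewrite scale0r add0r in c.
apply/cvgrPdist_lt => e e0; move/cvgrPdist_lt : c => /(_ e e0).
rewrite !near_withinE; apply: filterS => s.
have [->|st] := eqVneq s t; first by move=> _ _; rewrite subrr normr0.
by move=> + As => /(_ isT As); rewrite scalerA divff ?subr_eq0// scale1r subrK.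
Qed.

Lemma smooth_on_cvg (R : realType) (V W : normedModType R) (A : set V)
    (f : V -> W) (p : V) :
  smooth_on A f -> A p -> f @ within A (nbhs p) --> f p.
Proof.
move=> sf Ap; have [U [F [oU Up /(_ 0%N)[cF _] Ff]]] := sf _ Ap.
rewrite -Ff//; apply: (@cvg_trans _ (F @ within A (nbhs p))); last first.
  by apply: cvg_within_filter; exact: cF Up.
apply: near_eq_cvg; rewrite near_withinE.
near=> q => Aq; rewrite Ff//; near: q; exact: open_nbhs_nbhs.
Unshelve. all: by end_near. Qed.

(** * Affine changes of the parameter *)

Lemma affine_continuous (R : realType) (e k : R) :
  continuous (fun s : R => e * s + k).
Proof.
move=> t; apply: (@cvgD _ _ _ _ _ (fun s => e * s) (fun=> k)).
  exact: mulrl_continuous.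
exact: cvg_cst.
Qed.

(** The isometries of the line are the maps s |-> e * s + k with e ^+ 2 = 1;
    the form covers translations (e = 1), used to concatenate curves, and
    reflections (e = -1), used to reverse them. *)
Lemma is_derive_within_affine (R : realType) (W : normedModType R)
    (A B : set R) (e k : R) (f f' : R -> W) (t : R) (v : W) :
  e ^+ 2 = 1 -> (forall s, A s -> B (e * s + k)) ->
  (forall s, A s -> f' s = f (e * s + k)) -> A t ->
  is_derive_within B f (e * t + k) v -> is_derive_within A f' t (e *: v).
Proof.
move=> e2 AB ff' At dv.
have e0 : e != 0 by rewrite -sqrf_eq0 e2 oner_neq0.
have eV : e^-1 = e by apply: (mulfI e0); rewrite mulfV// -expr2.
have phi : (fun s => e * s + k) @ within A (dnbhs t) -->
    within B (dnbhs (e * t + k)).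
  move=> P PB; rewrite nbhs_simpl /= in PB; rewrite nbhs_simpl /=.
  suff H : \forall s \near t, s != t -> A s -> P (e * s + k) by exact: H.
  have H : \forall s \near t, e * s + k != e * t + k -> B (e * s + k) ->
      P (e * s + k) := @affine_continuous _ e k t _ PB.
  apply: filterS H => s /= H st As; apply: H; last exact: AB.
  by apply: contra st => /eqP/addIr/(mulfI e0) ->.
have c2 := cvg_comp _ _ phi dv.
pose q s := e *: ((e * s + k - (e * t + k))^-1 *:
                  (f (e * s + k) - f (e * t + k))).
apply: (@cvg_trans _ (q @ within A (dnbhs t))); last exact: cvgZl_tmp.
apply: near_eq_cvg.
rewrite near_withinE; near=> s => As /=.
rewrite /q ff'// ff'// scalerA; congr (_ *: _).
by rewrite opprD addrACA subrr addr0 -mulrBr invfM eV mulrA -expr2 e2 mul1r.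
Unshelve. all: by end_near. Qed.

Lemma C1_on_affine (R : realType) (W : normedModType R)
    (e k a a' b b' : R) (f f' v : R -> W) :
  e ^+ 2 = 1 -> (forall s, a <= s <= a' -> b <= e * s + k <= b') ->
  (forall s, a <= s <= a' -> f' s = f (e * s + k)) ->
  C1_on b b' f v -> C1_on a a' f' (fun s => e *: v (e * s + k)).
Proof.
move=> e2 ab ff' [cv dv]; split; last first.
  move=> s sa; apply: (is_derive_within_affine e2 _ _ _ (dv _ (ab _ sa))).
  - by move=> r; rewrite /= !in_itv; exact: ab.
  - by move=> r; rewrite /= !in_itv; exact: ff'.
  - by rewrite /= in_itv.
apply/subspace_continuousP => s sa; apply: cvgZl_tmp.
have c : (fun s => e * s + k) @ within `[a, a'] (nbhs s) -->
    within `[b, b'] (nbhs (e * s + k)).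
  move=> P PB; rewrite nbhs_simpl /= in PB; rewrite nbhs_simpl /=.
  suff H : \forall r \near s, (r \in `[a, a']) -> P (e * r + k) by exact: H.
  have H : \forall r \near s, (e * r + k \in `[b, b']) -> P (e * r + k) :=
    @affine_continuous _ e k s _ PB.
  by apply: filterS H => r H ra; apply: H; move: ra; rewrite !in_itv; exact: ab.
apply: (cvg_comp _ _ c); move/subspace_continuousP : cv; apply.
by move: sa; rewrite /= !in_itv; exact: ab.
Qed.

(** Makes the integrands of lengths measurable. *)
Lemma speed_continuous (R : realType) (M : topologicalType) (n : nat)
    (atlas : set (chart R M n)) (g : components R M n) (c : chart R M n)
    (gamma : R -> M) (b b' : R) (v : R -> 'rV[R]_n) :
  is_metric atlas g -> atlas c ->
  (forall s, b <= s <= b' -> cdom c (gamma s)) ->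
  C1_on b b' (cmap c \o gamma) v ->
  {within `[b, b'], continuous (speed g c gamma v)}.
Proof.
move=> gm ac cg [cv dv]; apply/subspace_continuousP => s sb.
have sb' : b <= s <= b' by move: sb; rewrite /= in_itv.
apply: cvg_norm_mx => [|i j]; first by move/subspace_continuousP : cv; apply.
have cs : ccod c (cmap c (gamma s)) by exists (gamma s) => //; exact: cg.
have cp : (fun p => g c p i j : R^o) @ nbhs (cmap c (gamma s)) -->
    (g c (cmap c (gamma s)) i j : R^o).
  have := smooth_on_cvg (metric_smooth gm i j ac) cs.
  by rewrite within_interior//; apply: open_nbhs_nbhs; split=> //; exact: ccod_open.
exact: cvg_comp (is_derive_within_cvg (dv _ sb')) cp.
Qed.

(** It suffices to compare both measures on half-open intervals; a reflection
    turns ]a, b] into an interval open on the other side, of equal measure. *)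
Lemma lebesgue_measure_affine (R : realType) (e k : R) (A : set R) :
  e ^+ 2 = 1 -> measurable A ->
  pushforward lebesgue_measure
    ((fun s => e * s + k) : R -> measurableTypeR R) A = lebesgue_measure A.
Proof.
move=> e2 mA; have mf : measurable_fun setT (fun s : R => e * s + k).
  by apply: continuous_measurable_fun; exact: affine_continuous.
apply/esym/lebesgue_measure_unique => //= _ [[a b]] _ <-.
have /eqP := e2; rewrite sqrf_eq1 /pushforward => /orP[]/eqP->.
  rewrite (_ : _ @^-1` _ = `]a - k, b - k]%classic).
    by rewrite !lebesgue_measure_itv/= !lte_fin ltrD2r -!EFinB opprB addrA subrK.
  by apply/seteqP; split => s /=; rewrite !in_itv/= mul1r lerBrDr ltrBlDr.
rewrite (_ : _ @^-1` _ = `[k - b, k - a[%classic).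
  rewrite !lebesgue_measure_itv/= !lte_fin ltrD2l ltrN2 -!EFinB.
  by case: ifP => // _; congr (_%:E); ring.
apply/seteqP; split => s /=; rewrite !in_itv/= mulN1r => /andP[? ?];
  by apply/andP; split; lra.
Qed.

Lemma integral_affine (R : realType) (e k a a' b b' : R) (h : R -> R) :
  e ^+ 2 = 1 -> (forall s, (b <= e * s + k <= b') = (a <= s <= a')) ->
  {within `[b, b'], continuous h} -> (forall s, 0 <= h s) ->
  (\int[lebesgue_measure]_(s in `[b, b']) (h s)%:E =
   \int[lebesgue_measure]_(s in `[a, a']) (h (e * s + k)%R)%:E)%E.
Proof.
move=> e2 ab ch h0.
pose phi : R -> measurableTypeR R := fun s => e * s + k.
have mphi : measurable_fun setT phi.
  by apply: continuous_measurable_fun; exact: affine_continuous.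
have -> : `[a, a']%classic = phi @^-1` `[b, b'].
  by apply/seteqP; split => s /=; rewrite !in_itv/= ab.
have mh : measurable_fun (`[b, b'] : set (measurableTypeR R)) (EFin \o h).
  by apply/measurable_EFinP; exact: subspace_continuous_measurable_fun.
transitivity (\int[pushforward lebesgue_measure phi]_(s in `[b, b'])
    (EFin \o h) s)%E; last first.
  by rewrite ge0_integral_pushforward// => s _; rewrite lee_fin.
by apply: eq_measure_integral => //= A mA _; exact/esym/lebesgue_measure_affine.
Qed.

(** The velocity becomes e *: v, which has the same norm as v. *)
Lemma C1_piece_affine (R : realType) (M : topologicalType) (n : nat)
    (atlas : set (chart R M n)) (g : components R M n) (c : chart R M n)
    (e k a a' b b' : R) (gamma gamma' : R -> M) (v : R -> 'rV[R]_n) :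
  is_metric atlas g -> atlas c ->
  e ^+ 2 = 1 -> (forall s, (b <= e * s + k <= b') = (a <= s <= a')) ->
  (forall s, a <= s <= a' -> gamma' s = gamma (e * s + k)) ->
  (forall s, b <= s <= b' -> cdom c (gamma s)) ->
  C1_on b b' (cmap c \o gamma) v ->
  exists v' : R -> 'rV[R]_n, C1_on a a' (cmap c \o gamma') v' /\
    (\int[lebesgue_measure]_(s in `[b, b']) (speed g c gamma v s)%:E =
     \int[lebesgue_measure]_(s in `[a, a']) (speed g c gamma' v' s)%:E)%E.
Proof.
move=> gm ac e2 ab gg cg cv; exists (fun s => e *: v (e * s + k)); split.
  apply: (C1_on_affine e2 _ _ cv) => s sa; first by rewrite ab.
  by rewrite /= gg.
rewrite (integral_affine e2 ab)//.
- apply: eq_integral => s; rewrite inE/= in_itv => sa.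
  rewrite /speed gg// linearZ/= -!scalemxAl -scalemxAr scalerA -expr2 e2.
  by rewrite scale1r.
- exact: speed_continuous gm ac cg cv.
- by move=> s; exact: sqrtr_ge0.
Qed.

(** * Symmetry and triangle inequality for the distance *)

Section curves.
Context (R : realType) (M : topologicalType) (n : nat).
Context (atlas : set (chart R M n)) (g : components R M n).

Lemma curve_length_itv (gamma : R -> M) (a b : R) (L : \bar R) :
  curve_length atlas g gamma a b L -> a <= b.
Proof. by elim=> // {}b b' {}L c v _ ab /ltW + _ _ _; exact: le_trans. Qed.

Lemma curve_length_cat (gamma : R -> M) (a b c : R) (L1 L2 : \bar R) :
  curve_length atlas g gamma a b L1 -> curve_length atlas g gamma b c L2 ->
  curve_length atlas g gamma a c (L1 + L2).
Proof.
move=> c1; elim=> [|b1 b' L ch v _ IH bb' ach dom C1]; first by rewrite adde0.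
by rewrite addeA; apply: curve_length_rcons.
Qed.

Hypothesis gm : is_metric atlas g.

(** Only the values of [gamma'] on the interval matter, so that the lemma also
    applies to a curve glued from two pieces. *)
Lemma curve_length_shift (k : R) (gamma gamma' : R -> M) (a b : R)
    (L : \bar R) :
  curve_length atlas g gamma a b L ->
  (forall s, a - k <= s <= b - k -> gamma' s = gamma (s + k)) ->
  curve_length atlas g gamma' (a - k) (b - k) L.
Proof.
elim=> [_|{}b b' {}L c v ab IH bb' ac dom C1 gg]; first exact: curve_length_nil.
have ab' := curve_length_itv ab.
have e2 : (1 : R) ^+ 2 = 1 by rewrite expr1n.
have gg' s : b - k <= s <= b' - k -> gamma' s = gamma (1 * s + k).
  by move=> /andP[? ?]; rewrite mul1r; apply: gg; apply/andP; split; lra.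
have abk s : (b <= 1 * s + k <= b') = (b - k <= s <= b' - k).
  by rewrite mul1r lerBlDr lerBrDr.
have [v' [C1' E]] := C1_piece_affine gm ac e2 abk gg' dom C1.
rewrite [X in (_ + X)%E]E; apply: curve_length_rcons => //.
- by apply: IH => s /andP[? ?]; apply: gg; apply/andP; split; lra.
- by rewrite ltrD2r.
- by move=> s sb; rewrite gg'//; apply: dom; rewrite abk.
Qed.

(** Reversal turns the last piece into the first one, while curves grow at
    their end: hence the concatenation of a one-piece curve with the
    reversed rest. *)
Lemma curve_length_rev (gamma : R -> M) (a b : R) (L : \bar R) :
  curve_length atlas g gamma a b L ->
  curve_length atlas g (gamma \o -%R) (- b) (- a) L.
Proof.
elim=> [|{}b b' {}L c v ab IH bb' ac dom C1]; first exact: curve_length_nil.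
have e2 : (- 1 : R) ^+ 2 = 1 by rewrite sqrrN expr1n.
have gg' s : - b' <= s <= - b -> (gamma \o -%R) s = gamma (- 1 * s + 0).
  by rewrite mulN1r addr0.
have abk s : (b <= - 1 * s + 0 <= b') = (- b' <= s <= - b).
  by rewrite mulN1r addr0 lerNr lerNl andbC.
have [v' [C1' E]] := C1_piece_affine gm ac e2 abk gg' dom C1.
rewrite [X in (_ + X)%E]E addeC; apply: curve_length_cat IH.
rewrite -[X in curve_length _ _ _ _ _ X]add0e.
apply: curve_length_rcons C1' => //; first exact: curve_length_nil.
- by rewrite ltrN2.
- by move=> s sb; rewrite gg'//; apply: dom; rewrite abk.
Qed.

Lemma riem_dist_sym (x y : M) : riem_dist atlas g x y = riem_dist atlas g y x.
Proof.
congr ereal_inf; apply/seteqP.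
by split => L [gamma [a [b [ga gb cL]]]]; exists (gamma \o -%R), (- b), (- a);
  split; rewrite /= ?opprK//; exact: curve_length_rev.
Qed.

(** With strict upper bounds, curves realizing them come directly from the
    definition of the infimum, and infinite distances need no separate case. *)
Lemma riem_dist_lt_add (x y z : M) (r s : \bar R) :
  (riem_dist atlas g x z < r -> riem_dist atlas g z y < s ->
   riem_dist atlas g x y < r + s)%E.
Proof.
move=> /ereal_inf_lt[L1 [gamma1 [a [b [g1a g1b c1]]]] L1r].
move=> /ereal_inf_lt[L2 [gamma2 [c [d [g2c g2d c2]]]] L2s].
apply: le_lt_trans (lteD L1r L2s); apply: ereal_inf_lbound.
pose gamma s := if s <= b then gamma1 s else gamma2 (s + (c - b)).
have cd := curve_length_itv c2; have ab := curve_length_itv c1.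
exists gamma, a, (d - (c - b)); split.
- by rewrite /gamma ab.
(* At the end point the first branch of [gamma] is chosen only when the
     second curve is reduced to a point. *)
- rewrite /gamma subrK; case: ifP => // db.
  have dc : d = c by apply/eqP; rewrite eq_le cd andbT; lra.
  by rewrite -g2d dc g2c -g1b subKr.
- apply: (@curve_length_cat _ _ b).
    rewrite -[a]subr0 -[b in curve_length _ _ _ _ b]subr0.
    apply: curve_length_shift c1 _ => t /andP[_]; rewrite subr0 addr0 => tb.
    by rewrite /gamma tb.
  rewrite -[b in curve_length _ _ _ b](subKr c).
  apply: curve_length_shift c2 _ => t /andP[ct td].
  rewrite /gamma; case: ifP => // tb.
  have tE : t = b by apply/eqP; rewrite eq_le tb; lra.
  by rewrite tE g1b -g2c; congr gamma2; ring.
Qed.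
End curves.

(** * Upper semicontinuity of the distance in time *)

Section flow_speed.
Context (R : realType) (M : topologicalType) (n : nat).
Context (atlas : set (chart R M n)) (I : set R) (g : R -> components R M n).
Hypothesis hg : is_ricci_flow atlas I g.

(** The smooth local extension given by [smooth_on] agrees with the metric near
    (t, p), because t is interior to I and the range of a chart is open. *)
Lemma flow_cvg (c : chart R M n) (i j : 'I_n) (t : R) (p : 'rV[R]_n) :
  atlas c -> nbhs t I -> ccod c p ->
  (fun tp : R * 'rV[R]_n => g tp.1 c tp.2 i j) @ (t, p) --> g t c p i j.
Proof.
move=> ac It cp.
have Icp : (I `*` ccod c) (t, p) by split => //=; exact: nbhs_singleton.
have := smooth_on_cvg (flow_smooth hg i j ac) Icp.
rewrite within_interior//; exists (I, ccod c) => //=; split => //=.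
by apply: open_nbhs_nbhs; split => //; exact: ccod_open.
Qed.

Context (c : chart R M n) (gamma : R -> M) (b b' t : R) (v : R -> 'rV[R]_n).
Hypothesis ac : atlas c.
Hypothesis dom : forall s, b <= s <= b' -> cdom c (gamma s).
Hypothesis C1 : C1_on b b' (cmap c \o gamma) v.
Hypothesis It : nbhs t I.

Lemma speed_flow_cvg (s : R) : b <= s <= b' ->
  (fun st : R * R => speed (g st.2) c gamma v st.1)
    @ filter_prod (within `[b, b'] (nbhs s)) (nbhs t) -->
  speed (g t) c gamma v s.
Proof.
move=> sb; have [cv dv] := C1.
apply: cvg_norm_mx => [|i j].
  have cvs : v @ within `[b, b'] (nbhs s) --> v s.
    by move/subspace_continuousP : cv; apply; rewrite /= in_itv.
  exact: cvg_comp (@cvg_fst _ _ _ _ _) cvs.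
have cs : ccod c (cmap c (gamma s)) by exists (gamma s) => //; exact: dom.
have cg := @flow_cvg c i j t (cmap c (gamma s)) ac It cs.
apply: (@cvg_comp _ _ _ (fun st : R * R => (st.2, cmap c (gamma st.1)))
  (fun tp : R * 'rV[R]_n => g tp.1 c tp.2 i j) _ _ _ _ cg).
apply: (@cvg_pair _ _ _ _ (nbhs t) (nbhs (cmap c (gamma s))) _ _ _ snd
  (fun st => cmap c (gamma st.1))); first exact: cvg_snd.
exact: cvg_comp (@cvg_fst _ _ _ _ _) (is_derive_within_cvg (dv _ sb)).
Qed.

(** The curve is compact, so that the pointwise bound coming from
    [speed_flow_cvg] near each parameter holds uniformly for t' near t. *)
Lemma speed_flow_near (e : R) : 0 < e ->
  \forall t' \near t, forall s, b <= s <= b' ->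
    speed (g t') c gamma v s <= speed (g t) c gamma v s + e.
Proof.
move=> e0.
have local (s : R) : b <= s <= b' -> \forall s' \near s & t' \near t,
    b <= s' <= b' ->
    speed (g t') c gamma v s' <= speed (g t) c gamma v s' + e.
  move=> sb.
  have It' := nbhs_singleton It.
  have gm := flow_metric hg It'.
  have c0 : speed (g t) c gamma v @ within `[b, b'] (nbhs s) -->
      speed (g t) c gamma v s.
    have := speed_continuous gm ac dom C1.
    by move/subspace_continuousP; apply; rewrite /= in_itv.
  have e2 : 0 < e / 2 by rewrite divr_gt0.
  set S := speed (g t) c gamma v s in c0.
  have lt1 : S < S + e / 2 by rewrite ltrDl.
  have lt2 : S - e / 2 < S by rewrite gtrBl.
  have := cvgr_lt S (speed_flow_cvg sb) _ lt1.
  case=> /= -[A B] [/= As Bt] AB.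
  have As' : \forall s' \near s, `[b, b']%classic s' -> A s' := As.
  have c1 : \forall s' \near s, `[b, b']%classic s' ->
      S - e / 2 < speed (g t) c gamma v s'.
    exact: (cvgr_gt S c0 _ lt2).
  exists ([set s' | `[b, b']%classic s' -> A s' /\ S - e / 2 < speed (g t) c gamma v s'],
    B) => /=.
    split => //; apply: (filterS2 _ _ As' c1) => s' h1 h2 sb'.
    by split; [exact: h1|exact: h2].
  move=> [s' t'] /= [h Bt'] sb'; have [As1 lt'] := h sb'.
  by have /= := AB (s', t') (conj As1 Bt'); lra.
have cov : near_covering_within (`[b, b']%classic : set R).
  apply/near_covering_withinP/compact_near_coveringP; exact: segment_compact.
have := cov R (nbhs t) (fun t' s => speed (g t') c gamma v s <=
  speed (g t) c gamma v s + e) _.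
move=> H; have {H} : \forall t' \near t, `[b, b']%classic `<=`
    (fun s => speed (g t') c gamma v s <= speed (g t) c gamma v s + e).
  apply: H => s; rewrite /= in_itv => /local.
  by apply: filterS => st /=; rewrite in_itv.
by apply: filterS => t' Ht' s sb; apply: Ht'; rewrite /= in_itv.
Qed.

End flow_speed.

(** By induction on the number of pieces: half of e is spent on the previous
    pieces, the other half on the last one. *)
Lemma curve_length_flow (R : realType) (M : topologicalType) (n : nat)
    (atlas : set (chart R M n)) (I : set R) (g : R -> components R M n)
    (gamma : R -> M) (a b t : R) (L : \bar R) :
  is_ricci_flow atlas I g -> nbhs t I ->
  curve_length atlas (g t) gamma a b L -> forall e : R, 0 < e ->
  \forall t' \near t, exists2 L' : \bar R,
    curve_length atlas (g t') gamma a b L' & (L' <= L + e%:E)%E.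
Proof.
move=> hg It; elim=> [|{}b b' {}L c v ab IH bb' ac dom C1] e e0.
  near=> t'; exists 0%E; first exact: curve_length_nil.
  by rewrite add0e lee_fin ltW.
have e20 : 0 < e / 2 by rewrite divr_gt0.
pose d := e / 2 / (b' - b).
have d0 : 0 < d by rewrite divr_gt0// subr_gt0.
have gm := flow_metric hg.
near=> t'.
have It' : I t' by near: t'.
have [L' cL' L'L] : exists2 L' : \bar R,
    curve_length atlas (g t') gamma a b L' & (L' <= L + (e / 2)%:E)%E.
  by near: t'; exact: IH.
have sp : forall s, b <= s <= b' ->
    speed (g t') c gamma v s <= speed (g t) c gamma v s + d.
  by near: t'; exact: (speed_flow_near hg ac dom C1 It d0).
eexists; first exact: curve_length_rcons cL' bb' ac dom C1.
have mS u : I u -> measurable_fun (`[b, b'] : set (measurableTypeR R))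
    (EFin \o speed (g u) c gamma v).
  move=> Iu; have cS := speed_continuous (gm _ Iu) ac dom C1.
  by apply/measurable_EFinP; exact: subspace_continuous_measurable_fun.
have -> : (e%:E = (e / 2)%:E + (e / 2)%:E)%E by rewrite -EFinD -splitr.
rewrite addeACA; apply: leeD => //.
have -> : ((e / 2)%:E = \int[lebesgue_measure]_(s in `[b, b']) (cst d%:E) s)%E.
  rewrite integral_cst//= lebesgue_measure_itv/= lte_fin bb' -EFinB -EFinM.
  by rewrite /d divfK// subr_eq0 gt_eqF.
have mSt := mS _ (nbhs_singleton It).
rewrite -ge0_integralD//=; last by move=> s _; rewrite lee_fin ltW.
apply: ge0_le_integral => //=.
- exact: mS.
- by apply: emeasurable_funD => //; exact: measurable_cst.
Unshelve. all: by end_near. Qed.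

(** A curve of length less than a at time t still has length less than a at
    nearby times. *)
Lemma riem_dist_flow_usc (R : realType) (M : topologicalType) (n : nat)
    (atlas : set (chart R M n)) (I : set R) (g : R -> components R M n)
    (x y : M) (t a : R) :
  is_ricci_flow atlas I g -> nbhs t I ->
  (riem_dist atlas (g t) x y < a%:E)%E ->
  \forall t' \near t, (riem_dist atlas (g t') x y < a%:E)%E.
Proof.
move=> hg It /ereal_inf_lt[L [gamma [b [b' [gb gb' cL]]]] La].
have [e e0 Lea] : exists2 e : R, 0 < e & (L + e%:E < a%:E)%E.
  case: L La {cL} => [l| |] //; last by exists 1; rewrite // ltNyr.
  by rewrite lte_fin => la; exists ((a - l) / 2); rewrite -?EFinD ?lte_fin; lra.
have := curve_length_flow hg It cL e0; apply: filterS => t' [L' cL' L'L].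
apply: le_lt_trans Lea; apply: le_trans L'L.
by apply: ereal_inf_lbound; exists gamma, b, b'.
Qed.

(** * Radii and the horizon *)

Lemma ereal_lt_between (R : realType) (b : R) (y : \bar R) :
  (b%:E < y)%E -> exists2 r : R, b < r & (r%:E < y)%E.
Proof.
case: y => [y| |] //; last by exists (b + 1); rewrite ?ltry ?ltrDl.
by rewrite lte_fin => by_; exists ((b + y) / 2); rewrite ?lte_fin; lra.
Qed.

Lemma horizon_gt0 (R : realType) (I : set R) (t : R) :
  I t -> t < 0 -> (0 < horizon I)%E.
Proof.
move=> It t0; have : (ereal_inf [set u%:E | u in I] <= t%:E)%E.
  by apply: ereal_inf_lbound; exists t.
rewrite /horizon; case: (ereal_inf _) => [m| |] /=; last by move=> _; exact: (ltry 0).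
  by rewrite lee_fin lte_fin sqrtr_gt0 oppr_gt0 => /le_lt_trans; apply.
by rewrite leNgt ltry.
Qed.

Lemma bound_applies_le (R : realType) (I : set R) (D B B' : \bar R) :
  (B' <= B)%E -> bound_applies I D B -> bound_applies I D B'.
Proof.
by move=> BB [?|?|BI]; [constructor 1|constructor 2|constructor 3; exact: le_lt_trans BI].
Qed.

(** By definition of the horizon, - r ^+ 2 lies strictly between the infimum
    and the supremum of I. *)
Lemma scale_time_interior (R : realType) (I : set R) (r : R) :
  is_interval I -> ereal_sup [set t%:E | t in I] = 0%E ->
  0 < r -> (r%:E < horizon I)%E -> nbhs (- r ^+ 2) I.
Proof.
move=> hI hsup r0; rewrite /horizon; set m := ereal_inf _ => rm.
have /ereal_inf_lt[_ [t1 It1 <-]] : (m < (- r ^+ 2)%:E)%E.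
  rewrite -[m]oppeK; move: rm; case: (- m)%E => [u| |] //=.
  - rewrite !lte_fin ltrN2 => ru.
    have u0 : 0 < u.
      by rewrite ltNge; apply/negP => /ler0_sqrtr u0; move: ru; rewrite u0; lra.
    by rewrite -(sqr_sqrtr (ltW u0)) ltr_pXn2r// ?nnegrE ?sqrtr_ge0 ?ltW.
  - by rewrite ltNyr.
  - by move=> rN; have : (r%:E < 0%:E)%E := rN; rewrite lte_fin ltNge ltW.
rewrite lte_fin => t1r.
have /ereal_sup_gt[_ [t2 It2 <-]] :
    ((- r ^+ 2)%:E < ereal_sup [set t%:E | t in I])%E.
  by rewrite hsup lte_fin oppr_lt0 exprn_gt0.
rewrite lte_fin => rt2.
have : (- r ^+ 2) \in `]t1, t2[ by rewrite in_itv /= t1r.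
move=> /near_in_itvoo; apply: filterS => t; rewrite in_itv /= => /andP[? ?].
by apply: (hI _ _ It1 It2); rewrite !ltW.
Qed.

(** For t = - r ^+ 2 the square root of |t| is r: in terms of radii the
    growth rate of distances is at most K. *)
Lemma RF4_scale (R : realType) (M : Type) (I : set R) (d : R -> M -> M -> \bar R)
    (K r s a : R) (x y : M) :
  RF4 I d K -> I (- r ^+ 2) -> I (- s ^+ 2) -> 0 < r -> r <= s ->
  (d (- r ^+ 2)%R x y < a%:E)%E ->
  (d (- s ^+ 2)%R x y < (a + K * (s - r))%:E)%E.
Proof.
move=> h Ir Is r0; rewrite le_eqVlt => /predU1P[<-|rs].
  by rewrite subrr mulr0 addr0.
have s0 : 0 < s by exact: lt_trans rs.
have st : - s ^+ 2 < - r ^+ 2 by rewrite ltrN2 ltr_pXn2r// nnegrE ltW.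
have := h x y _ _ Is Ir st.
rewrite !normrN !ger0_norm ?sqr_ge0// !sqrtr_sqr !gtr0_norm// => + da.
by move=> /le_lt_trans; apply; rewrite EFinD lteD2rE.
Qed.

(** * Scales of an abstract family of distances *)

Section scales.
Context (R : realType) (M : Type) (I : set R) (d : R -> M -> M -> \bar R).

Lemma rho_scale_ge0 (rho : R) (x y : M) : (0 <= rho_scale I d rho x y)%E.
Proof. by apply: le_ereal_inf_tmp => _ [r [r0 _ _] <-]; rewrite lee_fin ltW. Qed.

Lemma rho_scale_le (rho r : R) (x y : M) : 0 < r -> (r%:E < horizon I)%E ->
  (d (- r ^+ 2)%R x y < (r * rho)%:E)%E -> (rho_scale I d rho x y <= r%:E)%E.
Proof. by move=> *; apply: ereal_inf_lbound; exists r. Qed.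

Lemma rho_scale_lt_horizon (rho : R) (x y : M) :
  (rho_scale I d rho x y < +oo -> rho_scale I d rho x y < horizon I)%E.
Proof.
move=> /ereal_inf_lt[_ [r [r0 rI dr] <-] _].
exact: le_lt_trans (rho_scale_le r0 rI dr) rI.
Qed.

(** The way in which all upper bounds on scales are obtained: one shows that
    every radius above B and below the horizon is admissible.  If B is at
    least the horizon there is no such radius; then [bound_applies] leaves
    only the cases B = +oo and D < +oo, and in the latter D lies below the
    horizon by [rho_scale_lt_horizon]. *)
Lemma rho_scale_le_bound (rho : R) (x y : M) (B : \bar R) :
  (0 <= B)%E ->
  (forall r : R, (B < r%:E)%E -> (r%:E < horizon I)%E ->
     (d (- r ^+ 2)%R x y < (r * rho)%:E)%E) ->
  bound_applies I (rho_scale I d rho x y) B -> (rho_scale I d rho x y <= B)%E.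
Proof.
move=> B0 hB; suff BI : (B < horizon I -> rho_scale I d rho x y <= B)%E.
  case=> [hoo|Doo|//].
    have [/BI//|] := ltP B (horizon I).
    by rewrite hoo leye_eq => /eqP ->; rewrite leey.
  have [/BI//|IB] := ltP B (horizon I).
  exact/ltW/(lt_le_trans (rho_scale_lt_horizon Doo)).
move=> BI; rewrite leNgt; apply/negP => BD.
case: B B0 hB BI BD => [b| |] //; last by move=> _ _ _; rewrite ltNge leey.
move=> b0 hb bI bD.
have : (b%:E < Order.min (rho_scale I d rho x y) (horizon I))%E.
  by rewrite lt_min bD.
case/ereal_lt_between => r br; rewrite lt_min => /andP[rD rI].
have r0 : 0 < r by apply: le_lt_trans br; rewrite -lee_fin.
by have := rho_scale_le r0 rI (hb _ _ rI); rewrite leNgt rD lte_fin => /(_ br).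
Qed.

Hypothesis (hI : is_interval I) (hsup : ereal_sup [set t%:E | t in I] = 0%E).

Let IN (r : R) : 0 < r -> (r%:E < horizon I)%E -> I (- r ^+ 2).
Proof. by move=> r0 rI; apply: nbhs_singleton; exact: scale_time_interior. Qed.

Lemma rho_scale_sym (rho : R) (x y : M) :
  (forall t, I t -> d t x y = d t y x) ->
  rho_scale I d rho x y = rho_scale I d rho y x.
Proof.
move=> dC; congr (ereal_inf [set _ | r in _]); apply/seteqP.
by split => r [r0 rI dr]; split => //; move: dr; rewrite dC //; exact: IN.
Qed.

Lemma rho_scale_anti (rho1 rho2 : R) (x y : M) : rho1 <= rho2 ->
  (rho_scale I d rho2 x y <= rho_scale I d rho1 x y)%E.
Proof.
move=> rho12; apply: ereal_inf_le_tmp => _ [r [r0 rI dr] <-]; exists r => //.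
by split => //; apply: (lt_le_trans dr); rewrite lee_fin ler_wpM2l// ltW.
Qed.

Variable K : R.
Hypothesis (hK : 0 <= K) (hRF4 : RF4 I d K).

(** Some radius s < r is admissible; from s to r the distance grows by at most
    K * (r - s), and the bound r * rho by rho * (r - s), which is not less. *)
Lemma rho_scale_lt (rho r : R) (x y : M) : K <= rho ->
  (r%:E < horizon I)%E -> (rho_scale I d rho x y < r%:E)%E ->
  (d (- r ^+ 2)%R x y < (r * rho)%:E)%E.
Proof.
move=> Krho rI /ereal_inf_lt[_ [s [s0 sI ds] <-]]; rewrite lte_fin => sr.
have r0 := lt_trans s0 sr.
apply: lt_le_trans (RF4_scale hRF4 (IN s0 sI) (IN r0 rI) s0 (ltW sr) ds) _.
by rewrite lee_fin; nra.
Qed.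

(** By upper semicontinuity the strict inequality at r persists at slightly
    smaller radii. *)
Lemma lt_rho_scale (rho r : R) (x y : M) : 0 < r -> (r%:E < horizon I)%E ->
  (forall a : R, (d (- r ^+ 2)%R x y < a%:E)%E ->
     \forall t \near - r ^+ 2, (d t x y < a%:E)%E) ->
  (d (- r ^+ 2)%R x y < (r * rho)%:E)%E -> (rho_scale I d rho x y < r%:E)%E.
Proof.
move=> r0 rI usc dr.
have [b db br] : exists2 b : R, (d (- r ^+ 2)%R x y < b%:E)%E & b < r * rho.
  move: dr; case: (d _ _ _) => [u| |] //.
    by case/ereal_lt_between => b ub; rewrite lte_fin; exists b; rewrite ?lte_fin.
  by move=> _; exists (r * rho - 1); rewrite ?ltNyr; lra.
have usc' : \forall s \near r, (d (- s ^+ 2)%R x y < b%:E)%E.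
  have : (fun s : R => - s ^+ 2) @ r --> - r ^+ 2.
    by apply: cvgN; exact: exprn_continuous.
  by move=> /(_ _ (usc b db)).
have br' : \forall s \near r, b < s * rho.
  have : (fun s : R => s * rho) @ r --> r * rho by exact: mulrr_continuous.
  by move/cvgr_gt; apply.
have : \forall s \near r^'-,
    [/\ 0 < s, s < r, b < s * rho & (d (- s ^+ 2)%R x y < b%:E)%E].
  near=> s; split.
  - by near: s; exact: nbhs_left_gt.
  - by near: s; exact: nbhs_left_lt.
  - by near: s; exact: (@cvg_within _ (nbhs r)).
  - by near: s; exact: (@cvg_within _ (nbhs r)).
case/filter_ex => s [s0 sr bs ds].
apply: (@le_lt_trans _ _ s%:E); last by rewrite lte_fin.
apply: rho_scale_le => //; first by apply: lt_trans rI; rewrite lte_fin.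
by apply: lt_trans ds _; rewrite lte_fin.
Unshelve. all: by end_near. Qed.

Lemma rho_scale_eq0 (rho : R) (x y : M) : K <= rho -> (0 < horizon I)%E ->
  rho_scale I d rho x y = 0%E <->
  forall r : R, 0 < r -> (r%:E < horizon I)%E ->
    (d (- r ^+ 2)%R x y < (r * rho)%:E)%E.
Proof.
move=> Krho I0; split=> [D0 r r0 rI|H].
  by apply: rho_scale_lt; rewrite // D0 lte_fin.
apply/eqP; rewrite eq_le rho_scale_ge0 andbT.
by apply: rho_scale_le_bound => //; constructor 3.
Qed.

(** If r2 > D_rho2(x, y) then d_r < r2 * rho2 + K * (r - r2), which is
    r * rho1 for r = (rho2 - K) / (rho1 - K) * r2. *)
Lemma rho_scale_le_mul (rho1 rho2 : R) (x y : M) : K < rho1 -> rho1 <= rho2 ->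
  bound_applies I (rho_scale I d rho1 x y)
    (((rho2 - K) / (rho1 - K))%:E * rho_scale I d rho2 x y)%E ->
  (rho_scale I d rho1 x y <=
     ((rho2 - K) / (rho1 - K))%:E * rho_scale I d rho2 x y)%E.
Proof.
move=> Krho1 rho12; have k1 : 1 <= (rho2 - K) / (rho1 - K).
  by rewrite ler_pdivlMr ?mul1r; lra.
apply: rho_scale_le_bound => [|r].
  by rewrite mule_ge0// ?rho_scale_ge0// lee_fin; lra.
have k0 : 0 < (rho2 - K) / (rho1 - K) by lra.
rewrite muleC -lte_pdivlMr// => Dr rI.
have r0 : 0 < r / ((rho2 - K) / (rho1 - K)).
  by rewrite -lte_fin; apply: le_lt_trans Dr; exact: rho_scale_ge0.
set s := r / _ in Dr r0 *.
have rE : r = (rho2 - K) / (rho1 - K) * s by rewrite /s mulrC divfK// gt_eqF.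
have sr : s <= r by rewrite rE; nra.
have sI : (s%:E < horizon I)%E by apply: le_lt_trans rI; rewrite lee_fin.
have Krho2 : K <= rho2 by lra.
have ds := rho_scale_lt Krho2 sI Dr.
have Ir := IN (lt_le_trans r0 sr) rI.
apply: lt_le_trans (RF4_scale hRF4 (IN r0 sI) Ir r0 sr ds) _.
have : r * (rho1 - K) = (rho2 - K) * s by rewrite rE mulrAC divfK//; lra.
by rewrite lee_fin; lra.
Qed.

Hypothesis d_triangle : forall t (x y z : M) (a b : R), I t ->
  (d t x z < a%:E -> d t z y < b%:E -> d t x y < (a + b)%:E)%E.

(** Applying the triangle inequality at the larger radius s of r1 and r2, and
    only then moving the pair (x, y) to r, costs K * (r - min r1 r2), which is
    at most K * r. *)
Lemma dist_lt_add (r1 r2 a1 a2 r : R) (x y z : M) :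
  0 < r1 -> 0 < r2 -> r1 + r2 <= r -> (r%:E < horizon I)%E ->
  (d (- r1 ^+ 2)%R x z < a1%:E)%E -> (d (- r2 ^+ 2)%R z y < a2%:E)%E ->
  (d (- r ^+ 2)%R x y < (a1 + a2 + K * r)%:E)%E.
Proof.
move=> r10 r20 r12 rI d1 d2; pose s := Num.max r1 r2.
have s1 : r1 <= s by rewrite le_max lexx.
have s2 : r2 <= s by rewrite le_max lexx orbT.
have sr : s <= r by rewrite ge_max; apply/andP; split; lra.
have s0 := lt_le_trans r10 s1.
have sI : (s%:E < horizon I)%E by apply: le_lt_trans rI; rewrite lee_fin.
have I1 : I (- r1 ^+ 2) by apply: IN => //; apply: le_lt_trans sI; rewrite lee_fin.
have I2 : I (- r2 ^+ 2) by apply: IN => //; apply: le_lt_trans sI; rewrite lee_fin.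
have Is := IN s0 sI.
have := d_triangle Is (RF4_scale hRF4 I1 Is r10 s1 d1)
                      (RF4_scale hRF4 I2 Is r20 s2 d2).
have Ir := IN (lt_le_trans s0 sr) rI.
move=> /(RF4_scale hRF4 Is Ir s0 sr)/lt_le_trans; apply.
have : 0 <= K * (r1 + r2 - s).
  by rewrite mulr_ge0// /s maxEle; case: ifP; lra.
by rewrite lee_fin; lra.
Qed.

Lemma rho_scale_le_add (rho rho1 rho2 : R) (x y z : M) :
  K < rho - K -> rho - K <= rho1 -> rho - K <= rho2 ->
  bound_applies I (rho_scale I d rho x y)
    ((rho - K)^-1%:E *
       (rho1%:E * rho_scale I d rho1 x z + rho2%:E * rho_scale I d rho2 z y))%E ->
  (rho_scale I d rho x y <= (rho - K)^-1%:E *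
     (rho1%:E * rho_scale I d rho1 x z + rho2%:E * rho_scale I d rho2 z y))%E.
Proof.
move=> Krho h1 h2; have rK0 : 0 < rho - K by exact: le_lt_trans Krho.
have [rho10 rho20] : 0 < rho1 /\ 0 < rho2 by split; lra.
have rhs0 : (0 <= rho1%:E * rho_scale I d rho1 x z +
                  rho2%:E * rho_scale I d rho2 z y)%E.
  by rewrite adde_ge0// mule_ge0// ?rho_scale_ge0// lee_fin ltW.
apply: rho_scale_le_bound => [|r].
  by rewrite mule_ge0// lee_fin invr_ge0 ltW.
rewrite muleC lte_pdivrMr// => Dr rI.
have := rho_scale_ge0 rho1 x z; have := rho_scale_ge0 rho2 z y; move: Dr.
case D1: (rho_scale I d rho1 x z) => [A| |] //; last first.
  move=> + D20; rewrite gt0_muley ?lte_fin// addye ?ltNge ?leey//.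
  by rewrite gt_eqF// (@lt_le_trans _ _ 0%E)// mule_ge0// lee_fin ltW.
case D2: (rho_scale I d rho2 z y) => [B| |] //; last first.
  by rewrite gt0_muley ?lte_fin// addey ?ltNge ?leey.
rewrite !lee_fin -!EFinM -EFinD lte_fin => ABr B0 A0.
(* The slack is spread over both radii so that their weighted sum is exactly
   r * (rho - K). *)
pose e := (r * (rho - K) - (rho1 * A + rho2 * B)) / (rho1 + rho2).
have e0 : 0 < e by rewrite divr_gt0; lra.
have rE : rho1 * (A + e) + rho2 * (B + e) = r * (rho - K).
  rewrite !mulrDr addrACA -mulrDl /e [_ * (_ / _)]mulrC divfK; lra.
(* Both weights are at least rho - K. *)
have r12 : (A + e) + (B + e) <= r.
  rewrite -(ler_pM2r rK0) -rE; nra.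
have Ar : A + e <= r by lra.
have Br : B + e <= r by lra.
have AI : ((A + e)%:E < horizon I)%E by apply: le_lt_trans rI; rewrite lee_fin.
have BI : ((B + e)%:E < horizon I)%E by apply: le_lt_trans rI; rewrite lee_fin.
have DA : (d (- (A + e) ^+ 2)%R x z < ((A + e) * rho1)%:E)%E.
  by apply: rho_scale_lt => //; rewrite ?D1 ?lte_fin; lra.
have DB : (d (- (B + e) ^+ 2)%R z y < ((B + e) * rho2)%:E)%E.
  by apply: rho_scale_lt => //; rewrite ?D2 ?lte_fin; lra.
have A0' : 0 < A + e by lra.
have B0' : 0 < B + e by lra.
have := dist_lt_add A0' B0' r12 rI DA DB.
by rewrite [_ * rho1]mulrC [_ * rho2]mulrC rE [K * r]mulrC -mulrDr subrK.
Qed.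

Lemma rho_scale_add_le_max (rho1 rho2 : R) (x y z : M) :
  K <= rho1 -> K <= rho2 ->
  (rho_scale I d (rho1 + rho2) x z <=
     Order.max (rho_scale I d rho1 x y) (rho_scale I d rho2 y z))%E.
Proof.
move=> h1 h2; set D := Order.max _ _.
have [->|] := eqVneq D +oo%E; first exact: leey.
rewrite -ltey {}/D => Doo; apply: rho_scale_le_bound.
- by rewrite le_max rho_scale_ge0.
- move=> r; rewrite gt_max => /andP[D1 D2] rI.
  have r0 : 0 < r by rewrite -lte_fin; apply: le_lt_trans D1; exact: rho_scale_ge0.
  have d1 := rho_scale_lt h1 rI D1; have d2 := rho_scale_lt h2 rI D2.
  by rewrite mulrDr; exact: d_triangle (IN r0 rI) d1 d2.
- constructor 3; move: Doo; rewrite !gt_max => /andP[D1 D2].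
  by rewrite !rho_scale_lt_horizon.
Qed.
End scales.

(** * The properties of the scale of a Ricci flow *)

Theorem proposition3p2 (R : realType) (M : topologicalType) (n : nat)
    (atlas : set (chart R M n)) (I : set R) (g : R -> components R M n)
    (K rho : R)
    (hM : is_smooth_manifold atlas)
    (hI : is_interval I)
    (hsup : ereal_sup [set t%:E | t in I] = 0%E)
    (hI0 : exists2 t, I t & t < 0)
    (hg : is_ricci_flow atlas I g)
    (hK : 1 <= K)
    (hRF4 : RF4 I (fun t => riem_dist atlas (g t)) K)
    (hrho : 2 * K <= rho) :
  let d := fun t => riem_dist atlas (g t) in
  let D := fun r : R => rho_scale I d r in
  [/\ (* 1 *)
      forall x y : M, D rho x y = D rho y x /\ (0 <= D rho x y)%E,
      (* 2 *)
      (forall (x y : M) (r : R), 0 < r -> (r%:E < horizon I)%E ->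
         (D rho x y < r%:E)%E <-> (d (- r ^+ 2)%R x y < (r * rho)%:E)%E) /\
      (forall x y : M,
         D rho x y = 0%E <->
         forall r : R, 0 < r -> (r%:E < horizon I)%E ->
           (d (- r ^+ 2)%R x y < (r * rho)%:E)%E),
      (* 3 *)
      forall rho1 rho2 : R,
        rho - K <= rho1 -> rho - K <= rho2 -> K < rho - K ->
        forall x y z : M,
        [/\ bound_applies I (D rho x y)
              ((rho - K)^-1%:E *
                 (rho1%:E * D rho1 x z + rho2%:E * D rho2 z y))%E ->
            ((rho - K)%:E * D rho x y <=
               rho1%:E * D rho1 x z + rho2%:E * D rho2 z y)%E,
            bound_applies I (D rho x y)
              ((Num.max rho1 rho2 / (rho - K))%:E *
                 (D rho1 x z + D rho2 z y))%E ->
            (D rho x y <=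
               (Num.max rho1 rho2 / (rho - K))%:E *
                 (D rho1 x z + D rho2 z y))%E
          & rho1 = rho - K -> rho2 = rho - K ->
            bound_applies I (D rho x y)
              (D (rho - K)%R x z + D (rho - K)%R z y)%E ->
            (D rho x y <= D (rho - K)%R x z + D (rho - K)%R z y)%E],
      (* 4 *)
      forall rho1 rho2 : R, K <= rho1 -> rho1 <= rho2 ->
        forall x y : M,
        (D rho2 x y <= D rho1 x y)%E /\
        (K < rho1 ->
         bound_applies I (D rho1 x y)
           (((rho2 - K) / (rho1 - K))%:E * D rho2 x y)%E ->
         (D rho1 x y <= ((rho2 - K) / (rho1 - K))%:E * D rho2 x y)%E)
    & (* 5 *)
      forall rho1 rho2 : R, 2 * K <= rho1 -> 2 * K <= rho2 ->
        forall x y z : M,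
        (D (rho1 + rho2)%R x z <= Order.max (D rho1 x y) (D rho2 y z))%E].
Proof.
move=> d D.
have K0 : 0 <= K by lra.
have Krho : K <= rho by lra.
have dm t : I t -> is_metric atlas (g t) := @flow_metric _ _ _ _ _ _ hg t.
have d_sym x y t : I t -> d t x y = d t y x.
  by move=> /dm gt; exact: riem_dist_sym.
have d_tri t x y z (a b : R) : I t ->
    (d t x z < a%:E -> d t z y < b%:E -> d t x y < (a + b)%:E)%E.
  by move=> /dm gt; rewrite EFinD; exact: riem_dist_lt_add.
have [t0 It0 t0N] := hI0.
have h0 := horizon_gt0 It0 t0N.
split.
- by move=> x y; split; [apply: rho_scale_sym => // t; exact: d_sym
                       |exact: rho_scale_ge0].
- split=> [x y r r0 rI|x y]; last exact: (rho_scale_eq0 hI hsup hRF4 x y Krho h0).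
  split; first exact: (rho_scale_lt hI hsup hRF4 Krho).
  apply: lt_rho_scale => // a; apply: riem_dist_flow_usc hg _.
  exact: scale_time_interior.
- move=> rho1 rho2 h1 h2 hK' x y z.
  have rK0 : 0 < rho - K by lra.
  have V0 : 0 <= (rho - K)^-1 by rewrite invr_ge0 ltW.
  have [rho10 rho20] : 0 <= rho1 /\ 0 <= rho2 by split; lra.
  have D0 r u w : (0 <= D r u w)%E by exact: rho_scale_ge0.
  have main := rho_scale_le_add hI hsup K0 hRF4 d_tri hK' h1 h2.
  split.
  + by move=> /main; rewrite lee_pdivlMl.
  + have BB : ((rho - K)^-1%:E * (rho1%:E * D rho1 x z + rho2%:E * D rho2 z y) <=
        (Num.max rho1 rho2 / (rho - K))%:E * (D rho1 x z + D rho2 z y))%E.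
      rewrite mulrC EFinM -muleA lee_wpmul2l ?lee_fin//.
      by rewrite ge0_muleDr// leeD// lee_wpmul2r// lee_fin le_max lexx ?orbT.
    by move=> bD; exact: le_trans (main _ _ _ (bound_applies_le BB bD)) BB.
  + move=> E1 E2; move: main; rewrite E1 E2 => main bD.
    have BB : ((rho - K)^-1%:E * ((rho - K)%:E * D (rho - K)%R x z +
        (rho - K)%:E * D (rho - K)%R z y) = D (rho - K)%R x z + D (rho - K)%R z y)%E.
      by rewrite -ge0_muleDr// muleA -EFinM mulVf ?gt_eqF// mul1e.
    by rewrite -BB; apply: main; rewrite BB.
- move=> rho1 rho2 h1 h12 x y; split; first exact: rho_scale_anti.
  by move=> h1'; exact: (rho_scale_le_mul hI hsup hRF4 h1' h12).
- move=> rho1 rho2 h1 h2 x y z.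
  by apply: (rho_scale_add_le_max hI hsup hRF4 d_tri); lra.
Qed.
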